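(* Let $a,b$ be fixed positive integers with $b\le a$, and for positive integers $r$ let $\ell=ar$ and $k=br$. Let $\mathbb{E}[\ell,k]=\binom{\ell}{k}^{-1}\sum_{\mathbf{b}\in B_{\ell,k}} \rho(\mathbf{b})$ be the expected length of the right lane of a uniformly random arrival sequence of length $\ell$ with exactly $k$ zeros, where $\rho(\mathbf{b})$ is the number of cars in the right lane. Then, as $r\to\infty$ (so $\ell\to\infty$), $$\lim_{\ell\to\infty}\frac{\mathbb{E}[\ell,k]}{\ell}=\frac12\quad\text{when } \ell\ge 2k \ (\text{i.e. } a\ge 2b),$$ and $$\lim_{\ell\to\infty}\frac{\mathbb{E}[\ell,k]}{\ell}=\frac{b}{a}\quad\text{when } \ell<2k\ (\text{i.e. } a<2b).$$
   Context: An arrival sequence of length $\ell$ is a binary string $\mathbf{b}=b_1b_2\cdots b_\ell\in\{0,1\}^\ell$; $B_{\ell,k}$ is the set of those with exactly $k$ zeros. Cars $1,2,\dots,\ell$ arrive in order and choose between two initially empty lanes (left and right): if $b_i=0$, car $i$ enters the right lane; if $b_i=1$, car $i$ enters the currently shorter lane, and enters the right lane if both lanes have the same length. $\rho(\mathbf{b})$ denotes the final number of cars in the right lane. *)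

(* Defs.v *)
From HB Require Import structures.
From mathcomp Require Import all_boot all_order all_algebra.
From mathcomp Require Import all_classical all_reals all_analysis.
Set Implicit Arguments.
Unset Strict Implicit.
Unset Printing Implicit Defensive.
Import Order.TTheory GRing.Theory Num.Theory.
Import numFieldNormedType.Exports.
Local Open Scope ring_scope.

(* An arrival sequence is a tuple of booleans; [true] stands for the digit 1
   and [false] for the digit 0. *)
Definition arrivals (l k : nat) : {set l.-tuple bool} :=
  [set b : l.-tuple bool | count_mem false b == k].

(* A state (m, n) records m cars in the left lane and n in the right lane. *)
Definition park (s : nat * nat) (d : bool) : nat * nat :=
  let: (m, n) := s in
  if d && (m < n)%N then (m.+1, n) else (m, n.+1).

Definition rho (b : seq bool) : nat := (foldl park (0%N, 0%N) b).2.

Definition expected_right (R : realType) (l k : nat) : R :=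
  'C(l, k)%:R^-1 * \sum_(b in arrivals l k) (rho b)%:R.

(* Main.v *)
Require Import Defs.
From HB Require Import structures.
From mathcomp Require Import all_boot all_order all_algebra.
From mathcomp Require Import zify ring lra.
From mathcomp Require Import all_classical all_reals all_analysis.
Import Order.TTheory GRing.Theory Num.Theory.
Import numFieldNormedType.Exports.

(** Let D be the final excess of the right lane over the left one, so that
    2 rho = l + D. As a function of time D is a simple walk reflected at 0, whence
    D >= q := max(0, 2k - l), and at most C(l, j) of the sequences with k zeros have
    D > k - j. Summing over j, the mean of D exceeds q + 1 by at most
    (sum_(j < k') C(l, j)) / C(l, k') with k' = min(k, l - k). The telescoping
    identity sum_(j < k') (l - 2j) C(l, j) = k' C(l, k'), together with the
    monotonicity of C(l, j) in j <= l / 2, bounds this ratio by sqrt k'. Hence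
    E[l, k] = (l + q) / 2 + O(sqrt l). *)

(** * The excess as a walk reflected at 0 *)

Definition excess (b : seq bool) : nat :=
  let: (m, n) := foldl park (0, 0) b in n - m.

(** The last bound survives a digit 1 because such a digit widens the gap only from a tie, to 1;
    this is the source of the [.+1]. *)
Lemma foldl_parkP (b : seq bool) :
  let: (m, n) := foldl park (0, 0) b in
  [/\ m <= n, m + n = size b, count_mem false b <= n
    & n <= m + (count_mem false b).+1].
Proof.
elim/last_ind: b => [|b d] //.
rewrite foldl_rcons -cats1 size_cat count_cat /=.
case: (foldl _ _ b) => m n [le_mn mnE cn nc].
by case: d => /=; case: ltnP => lt_mn /=; split; lia.
Qed.

Lemma rhoE (b : seq bool) : 2 * rho b = size b + excess b.
Proof.
rewrite /rho /excess; have := foldl_parkP b.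
by case: (foldl _ _ b) => m n [] /=; lia.
Qed.

Lemma excess_ge (b : seq bool) : 2 * count_mem false b - size b <= excess b.
Proof.
rewrite /excess; have := foldl_parkP b.
by case: (foldl _ _ b) => m n []; lia.
Qed.

Lemma excess_le (b : seq bool) : excess b <= (count_mem false b).+1.
Proof.
rewrite /excess; have := foldl_parkP b.
by case: (foldl _ _ b) => m n []; lia.
Qed.

Lemma excess_rcons (b : seq bool) (d : bool) :
  excess (rcons b d) = if d && (0 < excess b) then (excess b).-1 else (excess b).+1.
Proof.
rewrite /excess foldl_rcons; have := foldl_parkP b.
case: (foldl _ _ b) => m n [le_mn _ _ _] /=.
by rewrite subn_gt0; case: d; case: ltnP => /=; lia.
Qed.

(** * Counting sequences by their last digit *)

Lemma card_tuple_rcons (l : nat) (P : pred (seq bool)) :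
  #|[set t : l.+1.-tuple bool | P t]|
  = #|[set t : l.-tuple bool | P (rcons t true)]|
    + #|[set t : l.-tuple bool | P (rcons t false)]|.
Proof.
pose h (u : bool * l.-tuple bool) : l.+1.-tuple bool := [tuple of rcons u.2 u.1].
have h_bij : bijective h.
  apply: inj_card_bij; last by rewrite card_prod !card_tuple expnS.
  move=> [x t] [y u] /(congr1 val) /= /rcons_inj [tu xy].
  by rewrite xy; congr pair; apply: val_inj.
rewrite -!sum1_card (reindex h) /=; last exact: onW_bij.
under eq_bigl do rewrite inE.
transitivity (\sum_(x : bool) \sum_(t : l.-tuple bool | P (rcons t x)) 1).
  by rewrite pair_big_dep.
by rewrite big_bool; congr addn; apply: eq_bigl => t; rewrite inE.
Qed.

Lemma count_mem_rcons (T : eqType) (x y : T) (s : seq T) :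
  count_mem x (rcons s y) = (y == x) + count_mem x s.
Proof. by rewrite -cats1 count_cat /= addn0 addnC. Qed.

Lemma card_arrivals (l k : nat) : #|arrivals l k| = 'C(l, k).
Proof.
elim: l k => [|l IHl] k.
  rewrite bin0n; case: k => [|k].
    rewrite (_ : arrivals 0 0 = [set [tuple]]) ?cards1 //.
    by apply/setP => t; rewrite !inE !tuple0 eqxx.
  by apply/eqP; rewrite cards_eq0; apply/eqP/setP => t; rewrite !inE tuple0.
rewrite (@card_tuple_rcons l (fun s => count_mem false s == k)).
rewrite (_ : [set t | _ (rcons _ true) == _] = arrivals l k); last first.
  by apply/setP => t; rewrite !inE count_mem_rcons.
rewrite IHl; case: k => [|k].
  rewrite (_ : [set t | _] = finset.set0) ?cards0 ?bin0 //.
  by apply/setP => t; rewrite !inE count_mem_rcons.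
rewrite binS -[in X in _ = _ + X]IHl; congr (_ + #|(_ : {set _})|).
by apply/setP => t; rewrite !inE count_mem_rcons.
Qed.

(* The bound given by the reflection principle; it is stable under Pascal's rule,
   so it follows by induction on the last car. *)
Lemma card_excess_gt (l m j : nat) :
  #|[set b in arrivals l (m + j) | m < excess b]| <= 'C(l, j).
Proof.
elim: l m j => [|l IHl] m j.
  rewrite (_ : [set b in _ | _] = finset.set0) ?cards0 //; apply/setP => t.
  by rewrite !inE tuple0 andbF.
(* At level 0 the bound counts all sequences. At higher levels the barrier is harmless: a digit 1
   met at excess 0 only yields excess 1. *)
case: m => [|m].
  rewrite -card_arrivals subset_leq_card //; apply/fintype.subsetP => t.
  by rewrite !inE => /andP[].
rewrite (_ : [set b in _ | _] = [set b : l.+1.-tuple bool |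
    (count_mem false b == m.+1 + j) && (m.+1 < excess b)]); last first.
  by apply/setP => t; rewrite !inE.
rewrite (@card_tuple_rcons l (fun s =>
    (count_mem false s == m.+1 + j) && (m.+1 < excess s))).
case: j => [|j].
  (* With [m.+1] zeros, a last digit 1 either lowers an excess of at most [m.+2] or raises 0 to 1,
     so the result never exceeds [m.+1]. *)
  rewrite (_ : [set t | _ && (_ < excess (rcons _ true))] = finset.set0).
    rewrite cards0 bin0 -(bin0 l) (leq_trans _ (IHl m 0)) // subset_leq_card //.
    by apply/fintype.subsetP => t; rewrite !inE count_mem_rcons excess_rcons /=; lia.
  apply/setP => t; rewrite !inE count_mem_rcons excess_rcons /= add0n.
  by apply/negbTE; have := excess_le t; case: (ltnP 0) => /=; lia.
(* Removing a last 0 sends the parameters [(m.+1, j.+1)] to [(m, j.+1)]; removing a last 1 sends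
   them to [(m.+2, j)]. These match the two terms of Pascal's rule. *)
rewrite binS addnC leq_add //.
  apply: leq_trans (IHl m j.+1); rewrite subset_leq_card //.
  by apply/fintype.subsetP => t; rewrite !inE count_mem_rcons excess_rcons /=; lia.
apply: leq_trans (IHl m.+2 j); rewrite subset_leq_card //.
apply/fintype.subsetP => t; rewrite !inE count_mem_rcons excess_rcons /=.
by case: (ltnP 0) => /=; lia.
Qed.

(** * Partial sums of binomial coefficients *)

Lemma sum_bin_telescope (l k : nat) : 2 * k <= l ->
  \sum_(j < k) (l - 2 * j) * 'C(l, j) = k * 'C(l, k).
Proof.
elim: k => [|k IHk] le_kl; first by rewrite big_ord0.
rewrite big_ord_recr /= IHk; last lia.
(* Here [k.+1 * 'C(l, k.+1) = (l - k) * 'C(l, k)], and [l - k] splits as [k + (l - 2 * k)] without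
   truncation. *)
rewrite mul_bin_left -mulnDl; congr muln; lia.
Qed.

(** For a given sum, the right side is smallest when the weight fills the lowest indices up to the
    cap [C], and initial odd numbers add up to a square. In the induction, [s <= n * C] and [x <= C]
    give [2 * s * x + x ^ 2 <= C * (2 * n + 1) * x]. *)
Lemma sqr_sum_le (n C : nat) (c : nat -> nat) : (forall i, i < n -> c i <= C) ->
  (\sum_(i < n) c i) ^ 2 <= C * \sum_(i < n) (2 * i).+1 * c i.
Proof.
elim: n => [|n IHn] le_cC; first by rewrite big_ord0.
have le_sum : \sum_(i < n) c i <= n * C.
  rewrite -[n in n * C]card_ord -sum_nat_const leq_sum // => i _.
  by rewrite le_cC // ltnS ltnW.
have {}IHn := IHn (fun i lt_in => le_cC i (ltnW lt_in)).
rewrite !big_ord_recr /=; have := le_cC n (leqnn _).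
move: (\sum_(i < n) _) (\sum_(i < n) _) (c n) IHn le_sum => s u x; nia.
Qed.

Lemma sqr_sum_bin_le (l k : nat) : 2 * k <= l ->
  (\sum_(j < k) 'C(l, j)) ^ 2 <= k * 'C(l, k) ^ 2.
Proof.
move=> le_kl.
have mono j : j < k -> 'C(l, j) <= 'C(l, j.+1).
  move=> lt_jk; rewrite -(leq_pmul2l (ltn0Sn j)) mul_bin_left leq_mul2r.
  by apply/orP; right; lia.
have le_bin j : j <= k -> 'C(l, j) <= 'C(l, k).
  move=> le_jk; rewrite -(subnK le_jk).
  have : k - j + j <= k by rewrite subnK.
  elim: (k - j) => // d IHd lt_dk.
  by rewrite (leq_trans (IHd (ltnW lt_dk))) // mono.
rewrite (reindex_inj rev_ord_inj) /=.
apply: leq_trans (@sqr_sum_le k 'C(l, k) (fun i => 'C(l, k - i.+1)) _) _.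
  by move=> i lt_ik; rewrite le_bin // leq_subr.
rewrite expnS expn1 mulnCA leq_mul2l; apply/orP; right.
(* At [j = k - i.+1] the telescoping weight [l - 2 * j] is at least [2 * i.+1], hence dominates
   [(2 * i).+1]. *)
rewrite -(sum_bin_telescope _ _ le_kl) [leqRHS](reindex_inj rev_ord_inj) /=.
by apply: leq_sum => i _; rewrite leq_mul2r; have := ltn_ord i; lia.
Qed.

(** * Bounds on the total excess *)

Lemma sum_excess_le (l k : nat) : k <= l ->
  exists s, \sum_(b in arrivals l k) excess b <= (2 * k - l).+1 * 'C(l, k) + s
    /\ s ^ 2 <= l * 'C(l, k) ^ 2.
Proof.
move=> le_kl; set q := 2 * k - l; set k' := k - q.
exists (\sum_(j < k') 'C(l, j)); split; last first.
  have -> : 'C(l, k) = 'C(l, k').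
    rewrite /k' /q; case: (leqP (2 * k) l) => [le|lt].
      by congr binomial; lia.
    by rewrite -bin_sub //; congr binomial; lia.
  by rewrite (leq_trans (@sqr_sum_bin_le l k' _)) ?leq_mul2r; lia.
(* Layer-cake summation: an excess is the number of levels [m] below it, and levels up to [k]
   suffice by [excess_le]. *)
have -> : \sum_(b in arrivals l k) excess b
    = \sum_(m < k.+1) #|[set b in arrivals l k | m < excess b]|.
  under [RHS]eq_bigr do rewrite -sum1dep_card big_mkcondr /=.
  rewrite exchange_big; apply: eq_bigr => b.
  rewrite inE => /eqP bk; have := excess_le b; rewrite bk => le_bk.
  by rewrite -big_mkcond (big_ord_narrow le_bk) sum1_card card_ord.
rewrite -(big_mkord xpredT (fun m => #|[set b in arrivals l k | m < excess b]|)).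
(* Each of the [q.+1] levels [m <= q] is bounded by the number of all sequences; a higher level
   [m = k - j] has [j < k'] and falls under [card_excess_gt]. *)
rewrite (big_cat_nat (n := q.+1)) //=; last by rewrite /q; lia.
apply: leq_add.
  rewrite -[q.+1 in X in _ <= X]subn0 -sum_nat_const_nat leq_sum // => m _.
  by rewrite -card_arrivals subset_leq_card //; apply/fintype.subsetP => t; rewrite inE => /andP[].
rewrite -(big_mkord xpredT (fun j => 'C(l, j))) big_nat_rev /=.
rewrite -{1}[q.+1]add0n big_addn subSS big_nat [leqRHS]big_nat leq_sum // => j /= lt_j.
have -> : q.+1 + k.+1 - (j + q.+1).+1 = k - j by lia.
by have := card_excess_gt l (k - j) j; rewrite subnK //; lia.
Qed.

Lemma sum_rhoE (l k : nat) :
  2 * (\sum_(b in arrivals l k) rho b)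
  = l * 'C(l, k) + \sum_(b in arrivals l k) excess b.
Proof.
rewrite big_distrr -card_arrivals mulnC -sum_nat_const -big_split /=.
by apply: eq_bigr => b _; rewrite rhoE size_tuple.
Qed.

Lemma sum_excess_ge (l k : nat) :
  (2 * k - l) * 'C(l, k) <= \sum_(b in arrivals l k) excess b.
Proof.
rewrite -card_arrivals mulnC -sum_nat_const leq_sum // => b.
by rewrite inE => /eqP <-; have := excess_ge b; rewrite size_tuple.
Qed.

(** * The expectation and its limit *)

Local Open Scope classical_set_scope.
Local Open Scope ring_scope.

Lemma expected_right_bounds (R : realType) (l k : nat) : (k <= l)%N ->
  (l + (2 * k - l))%:R / 2 <= expected_right R l k
    <= (l + (2 * k - l))%:R / 2 + (1 + Num.sqrt l%:R) / 2.
Proof.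
move=> le_kl; rewrite /expected_right -natr_sum.
have [s [le_s sqr_s]] := sum_excess_le l k le_kl.
have := sum_excess_ge l k; have := sum_rhoE l k.
move: (2 * k - l)%N le_s => q.
have := le_kl; rewrite -bin_gt0 => C_gt0.
move: (\sum_(b in arrivals l k) rho b)%N (\sum_(b in arrivals l k) excess b)%N
  => S D le_D SE ge_D.
have {}sqr_s : s%:R ^+ 2 <= l%:R * 'C(l, k)%:R ^+ 2 :> R.
  by rewrite -!natrX -natrM ler_nat.
have {}SE : 2 * S%:R = l%:R * 'C(l, k)%:R + D%:R :> R.
  by rewrite -natrM SE natrD natrM.
have {}ge_D : q%:R * 'C(l, k)%:R <= D%:R :> R by rewrite -natrM ler_nat.
have {}le_D : D%:R <= (q%:R + 1) * 'C(l, k)%:R + s%:R :> R.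
  by rewrite natr1 -natrM -natrD ler_nat.
rewrite natrD; move: C_gt0; rewrite -(ltr0n R).
move: 'C(l, k)%:R S%:R D%:R s%:R sqr_s SE ge_D le_D
  => C S' D' s' sqr_s SE ge_D le_D C_gt0.
have le_s : s' <= Num.sqrt l%:R * C.
  by rewrite -(ger0_norm (ltW C_gt0)) -sqrtr_sqr -sqrtrM // (le_trans (ler_norm _)) //
    -sqrtr_sqr ler_wsqrtr.
rewrite [C^-1 * _]mulrC ler_pdivlMr // ler_pdivrMr //.
apply/andP; split; nra.
Qed.

(** The truncated difference [2 * b - a] treats both regimes at once: the numerator is [a] when
    [2 * b <= a] and [2 * b] otherwise. *)
Lemma cvg_expected_right (R : realType) (a b : nat) : (0 < a)%N -> (b <= a)%N ->
  (expected_right R (a * r) (b * r) / (a * r)%N%:R : R) @[r --> \oo]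
    --> ((a + (2 * b - a))%:R / (2 * a%:R) : R).
Proof.
move=> a_gt0 le_ba; set L := (X in _ --> X).
have inv_cvg : ((a * r)%:R^-1 : R) @[r --> \oo] --> (0 : R).
  under eq_fun do rewrite natrM invfM.
  rewrite -(mulr0 (a%:R^-1 : R)); apply: cvgMl_tmp.
  apply/gtr0_cvgV0; last exact: cvgr_idn.
  by near=> r; rewrite ltr0n; near: r; exact: nbhs_infty_gt.
have sqrt_cvg : (Num.sqrt ((a * r)%:R^-1) : R) @[r --> \oo] --> (0 : R).
  by have := cvg_comp _ _ inv_cvg (@sqrt_continuous R 0); rewrite sqrtr0.
(* With [l = a * r], the error [(1 + sqrt l) / 2] divided by [l] is [(1 / l + sqrt (1 / l)) / 2]. *)
apply: (@squeeze_cvgr _ _ _ _ (fun=> L) (fun r => L +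
    ((a * r)%:R^-1 + Num.sqrt ((a * r)%:R^-1)) / 2)); last first.
- have -> : nbhs L = nbhs (L + (0 + 0) / 2) by rewrite addr0 mul0r addr0.
  by apply: cvgD; [exact: cvg_cst | apply: cvgMr_tmp; exact: cvgD].
- exact: cvg_cst.
near=> r.
have r_gt0 : (0 < r)%N by near: r; exact: nbhs_infty_gt.
have l_gt0 : 0 < (a * r)%:R :> R by rewrite ltr0n muln_gt0 a_gt0.
(* Truncated subtraction is homogeneous in [r], so the lower bound divided by [l] is exactly [L]. *)
have -> : L = (a * r + (2 * (b * r) - a * r))%:R / 2 / (a * r)%:R.
  rewrite mulnA -mulnBl -mulnDl /L !natrM.
  by field; rewrite !pnatr_eq0 -!lt0n r_gt0.
have le_l : (b * r <= a * r)%N by rewrite leq_mul2r le_ba orbT.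
have /andP[lo hi] := expected_right_bounds R _ _ le_l.
rewrite ler_pM2r ?invr_gt0 // lo /= ler_pdivrMr //.
apply: le_trans hi _; rewrite [leRHS]mulrDl divfK ?gt_eqF // lerD2l.
rewrite [leRHS]mulrAC [(_ + _) * _%:R]mulrDl mulVf ?gt_eqF //.
have -> // : Num.sqrt (a * r)%:R^-1 * (a * r)%:R = Num.sqrt (a * r)%:R :> R.
rewrite sqrtrV ?ltW // -[X in _ * X](sqr_sqrtr (ltW l_gt0)) expr2 mulKf //.
by rewrite gt_eqF // sqrtr_gt0.
Unshelve. all: by end_near. Qed.

Theorem corollary4p11 (R : realType) (a b : nat)
    (ha : (0 < a)%N) (hb : (0 < b)%N) (hba : (b <= a)%N) :
  ((2 * b <= a)%N ->
    (expected_right R (a * r) (b * r) / (a * r)%N%:R : R) @[r --> \oo]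
      --> (2^-1 : R)) /\
  ((a < 2 * b)%N ->
    (expected_right R (a * r) (b * r) / (a * r)%N%:R : R) @[r --> \oo]
      --> (b%:R / a%:R : R)).
Proof.
have a_neq0 : a%:R != 0 :> R by rewrite pnatr_eq0 -lt0n.
split=> [le_ba|lt_ab].
- rewrite (_ : 2^-1 = (a + (2 * b - a))%:R / (2 * a%:R)).
    exact: cvg_expected_right.
  by rewrite (eqP le_ba) addn0; field.
- rewrite (_ : b%:R / a%:R = (a + (2 * b - a))%:R / (2 * a%:R)).
    exact: cvg_expected_right.
  by rewrite subnKC 1?ltnW // natrM; field.
Qed.
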